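(* For Semantic Cutting Planes: (1) for any $k\ge 6$ there exists $m=O(n)$ such that $F\sim\mathrm{XOR}(m,n,k)$ requires refutations of depth at least $\Omega(n)$ with high probability; (2) for any $k\ge 6$ there exists $m=O(n)$ such that $F\sim\mathcal{F}(m,n,k)$ requires refutations of depth at least $\Omega(n)$ with high probability.
   Context: $\mathrm{XOR}(m,n,k)$ is the distribution on random $k$-XOR formulas over $n$ variables obtained by sampling $m$ equations from the set of all mod-$2$ linear equations with exactly $k$ variables; such a formula is refuted via its CNF encoding. $\mathcal{F}(m,n,k)$ is the distribution on random $k$-CNF formulas over $n$ variables obtained by sampling $m$ clauses from the set of all clauses with exactly $k$ variables. ''With high probability'' means with probability tending to $1$ as $n\to\infty$. Semantic Cutting Planes: a refutation of a CNF (encoded as $0\le x_i\le1$ and $\sum_{i\in P}x_i+\sum_{i\in N}(1-x_i)\ge1$ for each clause $\bigvee_{P}x_i\vee\bigvee_N\neg x_i$) is a sequence of linear inequalities, each an input inequality or deduced from at most two earlier ones provided every $\{0,1\}$ assignment satisfying the premises satisfies the conclusion, ending with an unsatisfiable inequality; its depth is the longest path in the proof DAG. *)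

(* Defs.v *)
From mathcomp Require Import all_boot all_order all_algebra.
From mathcomp Require Import all_classical all_reals all_analysis.

Set Implicit Arguments.
Unset Strict Implicit.
Unset Printing Implicit Defensive.

Import Order.TTheory GRing.Theory Num.Theory.
Local Open Scope ring_scope.

(* A pair (P, N) stands for the clause \/_(i in P) x_i \/ \/_(i in N) ~ x_i. *)
Definition clause (n : nat) : finType := ({set 'I_n} * {set 'I_n})%type.

Definition assignment (n : nat) : finType := {ffun 'I_n -> bool}.

Definition clause_sat n (x : assignment n) (c : clause n) : bool :=
  [exists i in c.1, x i] || [exists i in c.2, ~~ x i].

Definition cnf (n : nat) : finType := {set clause n}.

Definition cnf_unsat n (F : cnf n) : bool :=
  [forall x : assignment n, [exists c in F, ~~ clause_sat x c]].

Definition k_clauses (n k : nat) : {set clause n} :=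
  [set c : clause n | [disjoint c.1 & c.2] & #|c.1 :|: c.2| == k].

(* A pair (S, b) stands for the equation \sum_(i in S) x_i = b (mod 2). *)
Definition xor_eqn (n : nat) : finType := ({set 'I_n} * bool)%type.

Definition k_xor_eqns (n k : nat) : {set xor_eqn n} :=
  [set e : xor_eqn n | #|e.1| == k].

(* One clause per assignment to S violating the equation; the clause attached
   to T is falsified exactly by the assignments x with [set i in S | x i] = T. *)
Definition cnf_of_eqn n (e : xor_eqn n) : cnf n :=
  [set (e.1 :\: T, T) | T : {set 'I_n} in powerset e.1 & odd #|T| != e.2].

Definition cnf_of_clauses n m (w : {ffun 'I_m -> clause n}) : cnf n :=
  [set w j | j : 'I_m].

Definition cnf_of_eqns n m (w : {ffun 'I_m -> xor_eqn n}) : cnf n :=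
  \bigcup_(j < m) cnf_of_eqn (w j).

(* Probability of E for m independent uniform samples from D
   (with the junk value 0 when there is no such sample). *)
Definition sample_prob (R : realType) (T : finType) (D : {set T}) (m : nat)
    (E : {ffun 'I_m -> T} -> Prop) : R :=
  #|[set w in ffun_on D | `[< E w >] ]|%:R
  / #|[set w : {ffun 'I_m -> T} in ffun_on D]|%:R.

(* The inequality \sum_i lcoef i * x_i >= lrhs. *)
Record lin_ineq (R : realType) (n : nat) :=
  LinIneq { lcoef : 'rV[R]_n ; lrhs : R }.

Definition ineq_sat (R : realType) n (x : assignment n) (l : lin_ineq R n) :
    bool :=
  lrhs l <= \sum_(i < n) lcoef l 0 i * (x i)%:R.

Definition lower_bound_ineq (R : realType) n (i : 'I_n) : lin_ineq R n :=
  LinIneq (delta_mx 0 i) 0.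

Definition upper_bound_ineq (R : realType) n (i : 'I_n) : lin_ineq R n :=
  LinIneq (- delta_mx 0 i) (- 1).

(* \sum_(i in P) x_i + \sum_(i in N) (1 - x_i) >= 1, constants moved to the
   right-hand side. *)
Definition clause_ineq (R : realType) n (c : clause n) : lin_ineq R n :=
  LinIneq (\row_i ((i \in c.1)%:R - (i \in c.2)%:R)) (1 - #|c.2|%:R).

Definition is_input (R : realType) n (F : cnf n) (l : lin_ineq R n) : Prop :=
  [\/ exists i, l = lower_bound_ineq R i,
      exists i, l = upper_bound_ineq R i
    | exists2 c, c \in F & l = clause_ineq R c].

Definition entails (R : realType) n s (line : 'I_s -> lin_ineq R n)
    (A : {set 'I_s}) (l : lin_ineq R n) : Prop :=
  forall x : assignment n,
    (forall j, j \in A -> ineq_sat x (line j)) -> ineq_sat x l.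

(* A proof of s.+1 lines; prem p i is the set of lines from which line i is
   deduced, empty when line i is an input. *)
Record sem_proof (R : realType) (n : nat) := SemProof {
  psize : nat ;
  line : 'I_psize.+1 -> lin_ineq R n ;
  prem : 'I_psize.+1 -> {set 'I_psize.+1} }.
Arguments line {R n} p i : rename.
Arguments prem {R n} p i : rename.

Definition valid_line (R : realType) n (F : cnf n) (p : sem_proof R n)
    (i : 'I_(psize p).+1) : Prop :=
  (is_input F (line p i) /\ prem p i = finset.set0) \/
  [/\ (#|prem p i| <= 2)%N,
      forall j, j \in prem p i -> (j < i)%N
    & entails (line p) (prem p i) (line p i)].
Arguments valid_line {R n} F p i.

Definition refutation (R : realType) n (F : cnf n) (p : sem_proof R n) : Prop :=
  (forall i, valid_line F p i) /\
  (forall x : assignment n, ~~ ineq_sat x (line p ord_max)).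

Definition dag_edge (R : realType) n (p : sem_proof R n) :
  rel 'I_(psize p).+1 :=
  fun j i => j \in prem p i.
Arguments dag_edge {R n} p.

(* Length (number of edges) of a longest path; in a refutation edges go from
   smaller to larger indices, so all paths have at most psize p edges. *)
Definition depth (R : realType) n (p : sem_proof R n) : nat :=
  \max_(l < (psize p).+1 |
    [exists j, exists t : l.-tuple 'I_(psize p).+1, path (dag_edge p) j t])
  l.

(* Satisfiable formulas have no refutation; they are not counted as requiring
   deep ones. *)
Definition requires_depth (R : realType) n (F : cnf n) (d : R) : Prop :=
  cnf_unsat F /\
  forall p : sem_proof R n, refutation F p -> d <= (depth p)%:R.

(* Main.v *)
(* Let h(V, x) be the point equal to x on a set V of variables and to 1/2
   elsewhere.  If h(V, x) violates an inequality deduced from at most two others,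
   then fixing at most two more variables makes the point violate a premise:
   otherwise, rounding a vertex of the cube cut by the two hyperplanes through
   h(V, x) gives a Boolean z agreeing with x on V such that both z and its
   reflection in h(V, x) satisfy the premises, hence the conclusion, and so does
   their midpoint h(V, x).

   For an expanding system of equations such a walk from the last line towards
   the inputs lasts Omega(n) rounds.  After each round V is closed off: one adds
   the variables of a maximal set A of equations with at most 3 |A| boundary
   variables outside V.  Before the round every nonempty set of remaining
   equations had at least 4 boundary variables, hence still has 2 of them, so
   the equations of A determine no variable outside V and their solutions average
   to h(V, x); one of these solutions keeps the line violated.  A closed point
   violates no input clause, as it satisfies each equation it fixes entirely and
   leaves at least 4 variables of any other one at 1/2.

   A random k-uniform hypergraph with O(n) edges has
   |N(A)| >= (k - 5/4) |A| for all small A, hence boundaries of size at least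
   (k - 5/2) |A| >= (7/2) |A| when k >= 6.  A random clause is one of the clauses
   of the equation on its variables whose parity it excludes, which reduces k-CNF
   formulas to the same statement. *)

Require Import Defs.
From mathcomp Require Import all_boot all_order all_algebra.
From mathcomp Require Import all_classical all_reals all_analysis.
From mathcomp Require Import ring lra zify.

Import Order.TTheory GRing.Theory Num.Theory numFieldNormedType.Exports.
Import mathcomp.boot.fintype mathcomp.boot.finset.

Set Implicit Arguments.
Unset Strict Implicit.
Unset Printing Implicit Defensive.

(** * Boundary expansion *)

Section Hypergraph.
Variables (n m : nat) (S : 'I_m -> {set 'I_n}).
Implicit Types (A B T : {set 'I_m}) (V Q : {set 'I_n}) (x y : assignment n).

Definition neighbours A : {set 'I_n} := \bigcup_(j in A) S j.

(** The unique-neighbour boundary, relative to the variables [V] already fixed. *)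
Definition boundary A V : {set 'I_n} :=
  [set v | (v \notin V) && (#|[set j in A | v \in S j]| == 1)].

Definition parity (X : {set 'I_n}) x : bool := \big[addb/false]_(i in X) x i.

Lemma boundaryP A V v :
  reflect (v \notin V /\
           exists2 j, j \in A /\ v \in S j & forall i, i \in A -> v \in S i -> i = j)
          (v \in boundary A V).
Proof.
rewrite inE; apply: (iffP andP) => -[vV].
  move/cards1P => [j Ej]; split=> //; exists j.
    by have := set11 j; rewrite -Ej inE => /andP.
  by move=> i iA vi; apply/set1P; rewrite -Ej inE iA.
move=> [j [jA vj] uj]; split=> //; apply/cards1P; exists j.
apply/setP=> i; rewrite !inE; apply/andP/eqP => [[iA vi]|->//].
exact: uj.
Qed.

Lemma boundary_set0 V : boundary set0 V = set0.
Proof.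
apply/setP=> v; rewrite !inE; apply/negbTE/negP => /andP[_ /cards1P[j E]].
by have := set11 j; rewrite -E !inE.
Qed.

Lemma neighboursU A B : neighbours (A :|: B) = neighbours A :|: neighbours B.
Proof. by rewrite /neighbours bigcup_setU. Qed.

Lemma sub_neighbours A j : j \in A -> S j \subset neighbours A.
Proof. by move=> jA; apply: (bigcup_sup j). Qed.

(** A boundary variable of the union that occurs in [A] occurs there only once; one that misses [A]
    lies outside [neighbours A] and is charged to [B]. This lets closures be built in stages. *)
Lemma card_boundaryU A B V :
  #|boundary (A :|: B) V| <= #|boundary A V| + #|boundary B (V :|: neighbours A)|.
Proof.
apply: leq_trans (leq_card_setU _ _); apply/subset_leq_card/subsetP => v.
move=> /boundaryP[vV [j [jAB vj] uj]]; rewrite inE.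
have [vA|vA] := boolP (v \in neighbours A).
  apply/orP; left; apply/boundaryP; split=> //.
  have /bigcupP[i iA vi] := vA.
  exists i => // l lA vl.
  have -> : l = j by apply: uj => //; rewrite inE lA.
  by apply/esym/uj => //; rewrite inE iA.
apply/orP; right; apply/boundaryP; split.
  by rewrite inE negb_or vV.
exists j; last by move=> i iB; apply: uj; rewrite inE iB orbT.
split=> //; move: jAB; rewrite inE => /orP[jA|//].
by case/negP: vA; apply: (subsetP (sub_neighbours jA)).
Qed.

Lemma card_boundary_le A V Q : #|boundary A V| <= #|boundary A (V :|: Q)| + #|Q|.
Proof.
apply: leq_trans (leq_card_setU _ _); apply/subset_leq_card/subsetP => v.
move=> /boundaryP[vV vA]; rewrite inE orbC.
have [//|vQ /=] := boolP (v \in Q).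
by apply/boundaryP; split=> //; rewrite inE negb_or vV.
Qed.

Lemma card_boundary_subset A V Q :
  V \subset Q -> #|boundary A Q| <= #|boundary A V|.
Proof.
move=> VQ; apply/subset_leq_card/subsetP => v /boundaryP[vQ vA].
by apply/boundaryP; split=> //; apply: contra vQ => /(subsetP VQ).
Qed.

(** Double counting of incidences: a neighbour of [A] outside the boundary lies in at least two
    edges of [A]. *)
Lemma card_neighbours_boundary k A :
  (forall j, #|S j| = k) ->
  2 * #|neighbours A| <= k * #|A| + #|boundary A set0|.
Proof.
move=> Sk.
have -> : k * #|A| = \sum_(j in A) \sum_(v in S j) 1.
  rewrite (eq_bigr (fun=> k)) => [|j _]; last by rewrite sum1_card.
  by rewrite sum_nat_const mulnC.
rewrite (exchange_big_dep (mem (neighbours A))) /=; last first.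
  by move=> j v jA; apply: (subsetP (sub_neighbours jA)).
rewrite mulnC -sum_nat_const.
have -> : #|boundary A set0| = \sum_(v in neighbours A) (v \in boundary A set0).
  rewrite -sum1_card big_mkcond [RHS]big_mkcond /=; apply: eq_bigr => v _.
  case: ifP => [/boundaryP[_ [j [jA vj] _]]|_]; last by case: ifP.
  by rewrite (subsetP (sub_neighbours jA)).
rewrite -big_split /=; apply: leq_sum => v /bigcupP[j jA vj].
rewrite sum1dep_card.
have -> : #|[set i in A | v \in S i]|%N = #|[set i in A | v \in S i]|.-1.+1.
  by rewrite prednK //; apply/card_gt0P; exists j; rewrite inE jA.
rewrite !inE /=; case E : #|_| => [|[|c]] //=.
by have := card0_eq E j; rewrite !inE jA vj.
Qed.

Lemma eq_parity (X : {set 'I_n}) x y : {in X, x =1 y} -> parity X x = parity X y.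
Proof. by move=> xy; apply: eq_bigr => i /xy. Qed.

Lemma parity_card (X Z : {set 'I_n}) x :
  Z \subset X -> {in X, forall i, x i = (i \in Z)} -> parity X x = odd #|Z|.
Proof.
move=> ZX xZ; rewrite -sum1_card /parity.
rewrite (big_morph odd (id1 := false) (op1 := addb)) //; last exact: oddD.
rewrite [LHS]big_mkcond [RHS]big_mkcond /=; apply: eq_bigr => i _.
have [iX|iX] := boolP (i \in X); first by rewrite xZ //; case: (i \in Z).
by have /negbTE -> : i \notin Z by apply: contra iX; apply: (subsetP ZX).
Qed.

(** Peeling: a boundary variable [v] of [A] occurs in a single equation [j]. The other equations are
    solved by induction, and flipping [v] if needed repairs [j] alone. *)
Lemma peel_solution A V x0 (b : 'I_m -> bool) :
  (forall B, B \subset A -> B != set0 -> boundary B V != set0) ->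
  exists2 x : assignment n, {in V, x =1 x0} &
    forall j, j \in A -> parity (S j) x = b j.
Proof.
have [c] := ubnP #|A|; elim: c A => // c IHc A ltAc hA.
have [->|A0] := eqVneq A set0.
  by exists x0 => // j; rewrite inE.
have /set0Pn[v /boundaryP[vV [j [jA vj] uj]]] := hA A (subxx _) A0.
have [||x xV xA] := IHc (A :\ j).
- by rewrite (cardsD1 j) jA in ltAc.
- by move=> B sB; apply: hA; apply: subset_trans sB (subD1set _ _).
pose x' : assignment n := [ffun i => if i == v then x i (+) (parity (S j) x (+) b j) else x i].
exists x' => [i iV|i iA].
  rewrite ffunE; case: eqP => [E|_]; last exact: xV.
  by rewrite -E iV in vV.
have [->|ij] := eqVneq i j; last first.
  rewrite -(xA i) ?inE ?ij //; apply: eq_parity => l li; rewrite ffunE.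
  case: eqP => // E; rewrite E in li.
  by rewrite (uj i iA li) eqxx in ij.
rewrite /parity (bigD1 v) //= ffunE eqxx.
rewrite (eq_bigr x) => [|l /andP[_ /negbTE lv]]; last by rewrite ffunE lv.
rewrite /parity (bigD1 v) //=.
by case: (x v) (b j) (\big[_/_]_(_ in _ | _) _) => [] [] [].
Qed.

End Hypergraph.

(** * Half-integral points *)

Section HalfIntegral.
Variables (R : realType) (n m : nat) (S : 'I_m -> {set 'I_n}) (b : 'I_m -> bool).
Implicit Types (A B T : {set 'I_m}) (V Q : {set 'I_n}) (x y : assignment n).

Definition half_point V x (i : 'I_n) : R := (if i \in V then (x i)%:R else 2^-1)%R.

Definition solutions A V x0 : {set assignment n} :=
  [set x : assignment n |
    [forall i in V, x i == x0 i] && [forall j in A, parity (S j) x == b j]].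

Lemma solutionsP A V x0 x :
  reflect ({in V, x =1 x0} /\ forall j, j \in A -> parity (S j) x = b j)
          (x \in solutions A V x0).
Proof.
rewrite inE; apply: (iffP andP) => -[].
  move=> /forall_inP h1 /forall_inP h2; split.
    by move=> i /h1/eqP.
  by move=> j /h2/eqP.
by move=> h1 h2; split; apply/forall_inP => i; [move/h1->|move/h2->].
Qed.

(* A coordinate i outside V is not determined by the equations: some solution y
   of the homogeneous system has y i = 1, and adding y swaps the solutions with
   x i = 0 and those with x i = 1. *)
Lemma sum_solutions A V x0 (i : 'I_n) :
  (forall B, B \subset A -> B != set0 -> 1 < #|boundary S B V|) ->
  (\sum_(x in solutions A V x0) (x i)%:R =
    \sum_(x in solutions A V x0) half_point V x0 i :> R)%R.
Proof.
move=> hA; rewrite /half_point; have [iV|iV] := boolP (i \in V).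
  by apply: eq_bigr => x /solutionsP[-> ].
pose z : assignment n := [ffun l => l == i].
have [|y yV yA] := @peel_solution _ _ S A (i |: V) z (fun=> false).
  move=> B sB B0; rewrite -card_gt0.
  have := card_boundary_le S B V [set i]; have := hA B sB B0.
  rewrite cards1 setUC => h1 h2.
  by have := leq_trans h1 h2; rewrite addn1 ltnS.
have yi : y i = true by rewrite yV ?inE ?eqxx // ffunE eqxx.
have y0 l : l \in V -> y l = false.
  move=> lV; rewrite yV ?inE ?lV ?orbT // ffunE; apply/negbTE.
  by apply: contraNneq iV => <-.
pose f (x : assignment n) : assignment n := [ffun l => x l (+) y l].
have fK : involutive f by move=> x; apply/ffunP => l; rewrite !ffunE addbK.
have fS x : (f x \in solutions A V x0) = (x \in solutions A V x0).
  have imp x' : x' \in solutions A V x0 -> f x' \in solutions A V x0.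
    case/solutionsP => h1 h2; apply/solutionsP; split.
      by move=> l lV; rewrite ffunE y0 // addbF h1.
    move=> j jA; rewrite -(h2 j jA) -[RHS]addbF -(yA j jA) /parity -big_split /=.
    by apply: eq_bigr => l _; rewrite ffunE.
  by apply/idP/idP => [/imp|/imp //]; rewrite fK.
have : (\sum_(x in solutions A V x0) ((x i)%:R + (f x i)%:R) =
   \sum_(x in solutions A V x0) (2^-1 + 2^-1) :> R)%R.
  apply: eq_bigr => x _; rewrite ffunE yi addbT; case: (x i) => /=; lra.
rewrite !big_split /= (_ : (\sum_(x in _) (f x i)%:R)%R = (\sum_(x in solutions A V x0) (x i)%:R)%R :> R).
  lra.
rewrite [RHS](reindex_inj (inv_inj fK)) /=.
by apply: eq_bigl => x; rewrite fS.
Qed.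

(** Averaging: by [sum_solutions] the mean of the left-hand side over all solutions is the
    right-hand side, and some solution does not exceed the mean. *)
Lemma solution_le A V X x0 (c : 'I_n -> R) :
  (forall B, B \subset A -> B != set0 -> 1 < #|boundary S B V|) ->
  exists x : assignment n, [/\ {in V, x =1 x0},
    forall j, j \in A -> parity (S j) x = b j &
    (\sum_i c i * half_point (V :|: X) x i <= \sum_i c i * half_point V x0 i)%R].
Proof.
move=> hA.
have [|y yV yA] := @peel_solution _ _ S A V x0 b.
  by move=> B sB B0; by rewrite -card_gt0; apply: ltn_trans (hA B sB B0).
have yS : y \in solutions A V x0 by apply/solutionsP.
suff /existsP[x /andP[/solutionsP[h1 h2] le]] : [exists x in solutions A V x0,
  \sum_i c i * half_point (V :|: X) x i <= \sum_i c i * half_point V x0 i]%R.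
  by exists x.
apply: contraT; rewrite negb_exists => /forallP h.
have : (\sum_(x in solutions A V x0) \sum_i c i * half_point V x0 i <
  \sum_(x in solutions A V x0) \sum_i c i * half_point (V :|: X) x i)%R.
  apply: ltr_sum; first by apply/hasP; exists y => //; rewrite mem_index_enum.
  by move=> x xS; move: (h x); rewrite xS /= -ltNge.
rewrite exchange_big [ltRHS]exchange_big /=.
rewrite lt_neqAle => /andP[/eqP[]]; apply: eq_bigr => i _.
rewrite -!mulr_sumr; congr (_ * _)%R.
have [iX|iX] := boolP (i \in X).
  rewrite -sum_solutions //; apply: eq_bigr => x xS.
  by rewrite /half_point inE iX orbT.
apply: eq_bigr => x /solutionsP[xV _].
by rewrite /half_point inE (negbTE iX) orbF; case: ifP => // /xV ->.
Qed.

End HalfIntegral.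

(** * Points of the cube with few fractional coordinates *)

Section Vertex.
Variables (R : realFieldType) (n d : nat) (a : 'M[R]_(n, d)).
Local Open Scope ring_scope.

Definition fractional (y : 'rV[R]_n) : {set 'I_n} := [set i | 0 < y 0 i < 1].

(** Dimension count: annihilating the [d] columns of [a] and vanishing outside [F] are fewer than
    [n] linear conditions. *)
Lemma kernel_direction (F : {set 'I_n}) : (d < #|F|)%N ->
  exists u : 'rV[R]_n, [/\ u *m a = 0, u != 0 & forall i, i \notin F -> u 0 i = 0].
Proof.
move=> dF; pose D : 'M[R]_(n, #|~: F|) := \matrix_(i, l) (i == enum_val l)%:R.
have : kermx (row_mx a D) != 0.
  rewrite -mxrank_eq0 mxrank_ker -lt0n subn_gt0 (leq_ltn_trans (rank_leq_col _)) //.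
  by rewrite -[X in (_ < X)%N]card_ord -(cardsC F) ltn_add2r.
case/rowV0Pn => u /sub_kermxP; rewrite mul_mx_row => uM u0; exists u.
have [ua uD] : u *m a = 0 /\ u *m D = 0 by apply/eq_row_mx; rewrite uM row_mx0.
split=> // i iF; have iC : i \in ~: F by rewrite inE.
have /rowP/(_ (enum_rank_in iC i)) := uD; rewrite !mxE (bigD1 i) //= big1 => [|l li].
  by rewrite mxE enum_rankK_in // eqxx mulr1 addr0.
by rewrite mxE enum_rankK_in // (negbTE li) mulr0.
Qed.

(* Move from y inside the fractional coordinates, along the kernel of a, until one
   of them reaches 0 or 1. *)
Lemma vertex (y : 'rV[R]_n) : (forall i, 0 <= y 0 i <= 1) ->
  exists y' : 'rV[R]_n, [/\ forall i, 0 <= y' 0 i <= 1,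
    forall i, i \notin fractional y -> y' 0 i = y 0 i,
    y' *m a = y *m a & (#|fractional y'| <= d)%N].
Proof.
have [c] := ubnP #|fractional y|; elim: c y => // c IHc y ltc y01.
have [?|dF] := leqP #|fractional y| d; first by exists y.
have [u [ua u0 uF]] := kernel_direction dF.
have [i0 ui0] : exists i, u 0 i != 0.
  by move/rV0Pn: u0.
(* [g i] is the time at which coordinate [i], moving with speed [u 0 i], reaches 1 or 0; [i1] is the
   first to arrive. *)
pose g i := (if 0 < u 0 i then 1 - y 0 i else y 0 i) / `|u 0 i|.
have [i1 ui1 mini1] := @Order.TotalTheory.arg_minP _ _ _ i0 [pred i | u 0 i != 0] g ui0.
have frac i : u 0 i != 0 -> 0 < y 0 i < 1.
  move=> ui; suff : i \in fractional y by rewrite inE.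
  by apply: contraNT ui => /uF ->.
have gE i : u 0 i != 0 -> g i * u 0 i = if 0 < u 0 i then 1 - y 0 i else - y 0 i.
  rewrite /g => ui; case: ltrgt0P ui => // ui _.
    by rewrite divfK // gt_eqF.
  by rewrite invrN mulrN mulNr divfK // lt_eqF.
pose y1 := y + g i1 *: u.
have y1E i : y1 0 i = y 0 i + g i1 * u 0 i by rewrite !mxE.
have g0 : 0 <= g i1.
  have /andP[h1 h2] := frac _ ui1.
  by rewrite /g mulr_ge0 // ?invr_ge0 //; case: ifP => _; lra.
have y1F i : u 0 i = 0 -> y1 0 i = y 0 i by move=> ui; rewrite y1E ui mulr0 addr0.
have y101 i : 0 <= y1 0 i <= 1.
  have [/y1F ->//|ui] := eqVneq (u 0 i) 0.
  have /andP[h1 h2] := frac _ ui; rewrite y1E.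
  have := mini1 i ui; have := gE i ui.
  case: ltrgt0P ui => // ui _ E le; apply/andP; split.
  - exact: addr_ge0 (ltW h1) (mulr_ge0 g0 (ltW ui)).
  - by have := ler_wpM2r (ltW ui) le; lra.
  - by have := ler_wnM2r (ltW ui) le; lra.
  - by have := mulr_ge0_le0 g0 (ltW ui); lra.
have i1F1 : i1 \notin fractional y1.
  rewrite inE y1E gE //; case: ifP => _.
    by rewrite addrC subrK ltxx andbF.
  by rewrite subrr ltxx.
have sub : fractional y1 \subset fractional y :\ i1.
  apply/subsetP => i iF1; rewrite in_setD1.
  have -> /= : i != i1 by apply: contraNneq i1F1 => <-.
  apply: contraLR iF1 => iF; rewrite inE y1F ?uF //.
  by rewrite inE in iF.
have [|//|y' [h1 h2 h3 h4]] := IHc y1.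
  have := subset_leq_card sub; rewrite (cardsD1 i1 (fractional y)) in ltc.
  by rewrite inE frac // in ltc; move=> h; apply: leq_ltn_trans h _.
exists y'; split=> //.
  move=> i iF; rewrite h2 ?y1F ?uF //.
  by apply: contra iF => /(subsetP sub); rewrite in_setD1 => /andP[].
by rewrite h3 mulmxDl -scalemxAl ua scaler0 addr0.
Qed.

End Vertex.

(** * From a falsified conclusion to a falsified premise *)

Section ProofStep.
Variables (R : realType) (n : nat).
Local Open Scope ring_scope.

(** [Q] is the set of fractional coordinates of the point given by [vertex]. Rounding moves each of
    them by at most 1/2 and leaves the others, already Boolean, in place. *)
Lemma rounding d (a : 'M[R]_(n, d)) (V : {set 'I_n}) (x : assignment n) :
  exists (z : assignment n) (Q : {set 'I_n}),
  [/\ (#|Q| <= d)%N, [disjoint Q & V], {in V, z =1 x} & forall j,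
    `|\sum_i a i j * ((z i)%:R - half_point R V x i)| <= 2^-1 * \sum_(i in Q) `|a i j| ].
Proof.
pose y : 'rV[R]_n := \row_i half_point R V x i.
have y01 i : 0 <= y 0 i <= 1.
  by rewrite mxE /half_point; case: ifP => _; [case: (x i) => /=|]; lra.
have [y' [h1 h2 h3 h4]] := vertex a y01.
have yV i : i \in V -> i \notin fractional y.
  by move=> iV; rewrite inE mxE /half_point iV; case: (x i); rewrite ltxx ?andbF.
have y'V i : i \in V -> y' 0 i = (x i)%:R.
  by move=> iV; rewrite h2 ?yV // mxE /half_point iV.
exists [ffun i => 2^-1 < y' 0 i], (fractional y'); split=> //.
- rewrite disjoint_subset; apply/subsetP => i iF; apply/negP => /y'V E.
  by move: iF; rewrite inE E; case: (x i); rewrite ltxx ?andbF.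
- by move=> i iV; rewrite ffunE y'V //; case: (x i) => /=; [apply/idP|apply/negbTE; rewrite -leNgt]; lra.
move=> j; have -> : \sum_i a i j * (([ffun i => 2^-1 < y' 0 i] i)%:R - half_point R V x i)
   = \sum_i a i j * ((2^-1 < y' 0 i)%R%:R - y' 0 i).
  have /matrixP/(_ 0 j) := h3; rewrite !mxE => E.
  apply/eqP; rewrite -subr_eq0 -sumrB.
  rewrite (eq_bigr (fun i => y' 0 i * a i j - y 0 i * a i j)) => [|i _].
    by rewrite sumrB E subrr.
  by rewrite ffunE mxE; ring.
rewrite (bigID (mem (fractional y'))) /= [X in _ + X]big1 ?addr0; last first.
  move=> i; rewrite inE; have /andP[] := h1 i; rewrite !le_eqVlt.
  case: eqP => [<- _ _ _|_ /= ->].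
    by rewrite ltNge invr_ge0 ler0n subrr mulr0.
  by case: eqP => [-> _ _|_ /= ->//]; rewrite (_ : 2^-1 < 1) ?subrr ?mulr0 //; lra.
apply: le_trans (ler_norm_sum _ _ _) _; rewrite mulr_sumr; apply: ler_sum => i _.
rewrite normrM mulrC ler_wpM2r //; have /andP[] := h1 i.
by case: ltP => /=; rewrite ler_norml; lra.
Qed.

Definition falsified (V : {set 'I_n}) (x : assignment n) (l : lin_ineq R n) : Prop :=
  \sum_i lcoef l 0 i * half_point R V x i < lrhs l.

Lemma falsified_premise s (line : 'I_s -> lin_ineq R n) (A : {set 'I_s})
    (l : lin_ineq R n) V (x : assignment n) :
  entails line A l -> falsified V x l ->
  exists j (Q : {set 'I_n}) (x' : assignment n),
    [/\ j \in A, (#|Q| <= #|A|)%N, {in V, x' =1 x} & falsified (V :|: Q) x' (line j)].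
Proof.
move=> Al fl.
pose a : 'M[R]_(n, #|A|) := \matrix_(i, j) lcoef (line (enum_val j)) 0 i.
have [z [Q [Qd QV zV zQ]]] := rounding a V x.
pose value j := \sum_i lcoef (line j) 0 i * half_point R V x i.
have [/exists_inP[j jA jQ]|] := boolP [exists j in A,
  value j - 2^-1 * \sum_(i in Q) `|lcoef (line j) 0 i| < lrhs (line j)].
  (* On [Q] the minimizing Boolean value is chosen: compared with 1/2, each coordinate lowers the
     sum by half its absolute coefficient. *)
  pose x' : assignment n := [ffun i => if i \in V then x i else lcoef (line j) 0 i < 0].
  exists j, Q, x'; split=> //; first by move=> i iV; rewrite ffunE iV.
  apply: le_lt_trans jQ; rewrite /value [X in _ - _ * X]big_mkcond /= mulr_sumr -sumrB.
  apply: ler_sum => i _; rewrite /half_point ffunE inE.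
  have [iV|iV] := boolP (i \in V).
    by rewrite (disjointFl QV iV) mulr0 subr0.
  have [iQ|iQ] /= := boolP (i \in Q); last by rewrite mulr0 subr0.
  by case: (ltP (lcoef (line j) 0 i) 0) => h; [rewrite ltr0_norm|rewrite ger0_norm]; rewrite //=; lra.
move=> /exists_inPn noj; exfalso.
(* The reflection of [z] in the half-integral point; deviations only change sign, so the bounds of
   [rounding] hold for it too. *)
pose z' : assignment n := [ffun i => if i \in V then x i else ~~ z i].
have zE i : (z' i)%:R - half_point R V x i = - ((z i)%:R - half_point R V x i).
  rewrite ffunE /half_point; case: ifP => iV; first by rewrite zV // subrr oppr0.
  by case: (z i) => /=; lra.
have sat (y : assignment n) : (forall j, j \in A -> `|\sum_i lcoef (line j) 0 i * ((y i)%:R - half_point R V x i)|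
    <= 2^-1 * \sum_(i in Q) `|lcoef (line j) 0 i|) -> ineq_sat y l.
  move=> yQ; apply: Al => j jA; move: (yQ j jA) (noj j jA).
  rewrite -leNgt /ineq_sat ler_norml => /andP[+ _].
  have -> : \sum_i lcoef (line j) 0 i * ((y i)%:R - half_point R V x i) =
      \sum_i lcoef (line j) 0 i * (y i)%:R - value j.
    by rewrite -sumrB; apply: eq_bigr => i _; rewrite mulrBr.
  lra.
have zl : ineq_sat z l.
  apply: sat => j jA; have := zQ (enum_rank_in jA j).
  under eq_bigr do rewrite mxE enum_rankK_in //.
  by under [X in _ <= _ * X -> _]eq_bigr do rewrite mxE enum_rankK_in //.
have z'l : ineq_sat z' l.
  apply: sat => j jA; have := zQ (enum_rank_in jA j).
  under eq_bigr do rewrite mxE enum_rankK_in //.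
  under [X in _ <= _ * X -> _]eq_bigr do rewrite mxE enum_rankK_in //.
  by under [X in _ -> `|X| <= _]eq_bigr do rewrite zE mulrN; rewrite sumrN normrN.
move: fl zl z'l; rewrite /falsified /ineq_sat.
have -> : \sum_i lcoef l 0 i * (z' i)%:R =
  2 * (\sum_i lcoef l 0 i * half_point R V x i) - \sum_i lcoef l 0 i * (z i)%:R.
  rewrite mulr_sumr -sumrB; apply: eq_bigr => i _.
  have -> : (z' i)%:R = 2 * half_point R V x i - (z i)%:R by have := zE i; lra.
  by ring.
lra.
Qed.

End ProofStep.

(** * Depth of refutations of expanding systems *)

Lemma cardsU_disjoint (T : finType) (A B : {set T}) :
  [disjoint A & B] -> #|A :|: B| = #|A| + #|B|.
Proof. by move=> AB; rewrite cardsU disjoint_setI0 // cards0 subn0. Qed.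

Lemma disjoint_setU (T : finType) (A B C : {set T}) :
  [disjoint A & B :|: C] = [disjoint A & B] && [disjoint A & C].
Proof. by rewrite -!setI_eq0 setIUr setU_eq0. Qed.

(** Start of the walk: [solution_le] without equations and with negated coefficients would turn
    satisfaction at the all-1/2 point into a Boolean point satisfying [l]. *)
Lemma unsat_falsified (R : realType) n (l : lin_ineq R n) x :
  (forall y : assignment n, ~~ ineq_sat y l) -> falsified set0 x l.
Proof.
move=> unsat; rewrite /falsified ltNge; apply/negP => le.
have [|y [_ _]] := @solution_le R n 0 (fun=> set0) (fun=> false) set0 set0 setT x
  (fun i => - lcoef l 0 i)%R.
  by move=> B; rewrite subset0 => /eqP ->; rewrite eqxx.
under eq_bigr do rewrite mulNr.
under [X in (_ <= X)%R -> _]eq_bigr do rewrite mulNr.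
rewrite !sumrN lerN2 => le'; case/negP: (unsat y).
apply: le_trans le (le_trans le' _).
by apply: ler_sum => i _; rewrite /half_point set0U inE.
Qed.

Section DepthBound.
Variables (R : realType) (n m : nat) (S : 'I_m -> {set 'I_n}) (b : 'I_m -> bool).
Variable r : nat.
Hypothesis expansion :
  forall A : {set 'I_m}, #|A| <= 2 * r -> 7 * #|A| <= 2 * #|boundary S A set0|.
Implicit Types (A B T : {set 'I_m}) (V Q P : {set 'I_n}) (x y : assignment n).

(** The threshold 3 lies below the expansion rate 7/2, which keeps critical sets small; a
    noncritical nonempty set has at least 4 boundary variables, enough to lose two and keep two. *)
Definition critical A V : bool := #|boundary S A V| <= 3 * #|A|.

Lemma criticalU A B V : [disjoint A & B] -> critical A V ->
  critical B (V :|: neighbours S A) -> critical (A :|: B) V.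
Proof.
rewrite /critical => AB hA hB; rewrite cardsU_disjoint // mulnDr.
by apply: leq_trans (card_boundaryU _ _ _ _) _; apply: leq_add.
Qed.

(** Fixing [V] removes at most [#|V|] boundary variables, so [7/2 #|A| <= 3 #|A| + #|V|]. *)
Lemma critical_small A V : #|A| <= 2 * r -> critical A V -> #|A| <= 2 * #|V|.
Proof.
move=> /expansion h1 h2.
have h3 := card_boundary_le S A set0 V; rewrite set0U in h3.
rewrite /critical in h2; move: #|boundary _ _ _| #|boundary _ _ _| h1 h2 h3; lia.
Qed.

(* In round t the fixed variables V are the variables Q fixed by the adversary
   together with those of the equations in the closure T. *)
Record state t V x : Prop := State {
  state_Q : {set 'I_n} ;
  state_T : {set 'I_m} ;
  state_V : V = state_Q :|: neighbours S state_T ;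
  state_card : #|state_Q| <= 2 * t ;
  state_le : #|state_T| <= r ;
  state_critical : critical state_T state_Q ;
  state_sat : forall j, j \in state_T -> parity (S j) x = b j ;
  state_residual : forall A, [disjoint A & state_T] -> A != set0 -> #|A| <= r ->
    ~~ critical A V }.

Lemma initial_state x : state 0 set0 x.
Proof.
exists set0 set0; rewrite /critical ?cards0 //.
- by rewrite set0U /neighbours big_set0.
- by rewrite boundary_set0 cards0.
- by move=> j; rewrite inE.
move=> A _ A0 Ar; rewrite -ltnNge.
have := expansion (leq_trans Ar (leq_pmull _ _)) => /(_ isT).
rewrite -card_gt0 in A0; move: #|A| #|boundary _ _ _| A0 => c d; lia.
Qed.

(** The closure grows by a largest candidate [A], critical over [V :|: P]. A critical set left over
    afterwards would merge with [A] into a larger candidate. Values on the new variables come from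
    [solution_le], which keeps [l] falsified. *)
Lemma next_state t V P x x' (l : lin_ineq R n) :
  state t V x -> #|P| <= 2 -> 4 * t.+1 <= r -> {in V, x' =1 x} ->
  falsified (V :|: P) x' l ->
  exists V' y, state t.+1 V' y /\ falsified V' y l.
Proof.
move=> [Q T VE Qt Tr Tcrit Tsat Tres] P2 tr x'V fl.
pose cand A := [&& [disjoint A & T], #|A| <= r & critical A (V :|: P)].
have cand0 : cand set0.
  by rewrite /cand /critical boundary_set0 !cards0 -setI_eq0 set0I eqxx.
have [A /and3P[AT Ar Acrit] Amax] := @arg_maxnP _ set0 cand (fun A => #|A|) cand0.
have Abd B : B \subset A -> B != set0 -> 1 < #|boundary S B (V :|: P)|.
  move=> BA B0.
  have := Tres B (disjointWl BA AT) B0 (leq_trans (subset_leq_card BA) Ar).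
  have h := card_boundary_le S B V P; rewrite /critical -ltnNge.
  rewrite -card_gt0 in B0; move: #|B| B0 #|P| P2 h => c c0 p p2.
  move: #|_| #|_|; lia.
have [y [yV yA yl]] := solution_le b (neighbours S A) x' (fun i => lcoef l 0 i)%R Abd.
exists ((V :|: P) :|: neighbours S A), y; split; last exact: le_lt_trans yl fl.
have V'E : V :|: P = (Q :|: P) :|: neighbours S T by rewrite VE setUAC.
have V''E : (V :|: P) :|: neighbours S A = (Q :|: P) :|: neighbours S (T :|: A).
  by rewrite V'E neighboursU setUA.
have QPt : #|Q :|: P| <= 2 * t.+1.
  by rewrite mulnS addnC; apply: leq_trans (leq_card_setU _ _) (leq_add _ _).
have T'crit : critical (T :|: A) (Q :|: P).
  apply: criticalU; first by rewrite disjoint_sym.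
    by apply: leq_trans Tcrit; apply/card_boundary_subset/subsetUl.
  by rewrite -V'E.
(* Size at most [2 * r] improves to [2 * #|Q :|: P| <= 4 * t.+1 <= r], so that unions of two sets of
   size at most [r] stay under control. *)
have small B : #|B| <= 2 * r -> critical B (Q :|: P) -> #|B| <= r.
  by move=> Br /(critical_small Br); move: #|B| #|_| QPt; lia.
have T'r : #|T :|: A| <= 2 * r.
  by rewrite mul2n -addnn; apply: leq_trans (leq_card_setU _ _) (leq_add _ _).
exists (Q :|: P) (T :|: A) => //.
- exact: small.
- move=> j; rewrite inE => /orP[jT|]; last exact: yA.
  rewrite -(Tsat j jT); apply: eq_parity => i ij.
  have iV : i \in V by rewrite VE inE (subsetP (sub_neighbours S jT)) ?orbT.
  by rewrite yV ?x'V // inE iV.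
move=> B; rewrite disjoint_setU => /andP[BT BA] B0 Br; apply/negP => Bcrit.
have TABcrit : critical (T :|: A :|: B) (Q :|: P).
  apply: criticalU => //; last by rewrite -V''E.
  by rewrite disjoint_sym disjoint_setU BT.
have TABr : #|T :|: A :|: B| <= r.
  apply: (small _) => //; apply: leq_trans (leq_card_setU _ _) _.
  by rewrite mul2n -addnn; apply: leq_add => //; apply: small.
have /Amax : cand (A :|: B).
  apply/and3P; split.
  - by rewrite disjoint_sym disjoint_setU !(disjoint_sym T) AT.
  - by apply: leq_trans TABr; rewrite -setUA; apply/subset_leq_card/subsetUr.
  - by apply: criticalU; rewrite // disjoint_sym.
rewrite /= cardsU_disjoint 1?disjoint_sym // -[X in _ <= X]addn0 leq_add2l leqn0 cards_eq0.
by rewrite (negbTE B0).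
Qed.

Lemma input_not_falsified (F : cnf n) t V x (l : lin_ineq R n) :
  (forall c, c \in F -> exists j, [/\ c.1 = S j :\: c.2, c.2 \subset S j
     & odd #|c.2| != b j]) ->
  0 < r -> state t V x -> is_input F l -> ~ falsified V x l.
Proof.
move=> Fb r0 [Q T VE _ _ _ Tsat Tres].
have h01 i : (0 <= half_point R V x i <= 1)%R.
  by rewrite /half_point; case: ifP => _; [case: (x i) => /=|]; lra.
rewrite /falsified => -[[i ->]|[i ->]|[c /Fb[j [c1 c2 cb]] ->]] /=.
- rewrite (bigD1 i) //= big1 => [|i' /negbTE ii']; last by rewrite mxE eqxx ii' mul0r.
  by rewrite mxE !eqxx /=; have := h01 i; lra.
- rewrite (bigD1 i) //= big1 => [|i' /negbTE ii'].
    by rewrite !mxE !eqxx /=; have := h01 i; lra.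
  by rewrite !mxE eqxx ii' oppr0 mul0r.
(* [w i] is the value of the literal of [c] on variable [i] at the half-integral point. *)
pose w i : R := (if i \in c.2 then 1 - half_point R V x i else half_point R V x i)%R.
have w0 i : (0 <= w i)%R by rewrite /w; case: ifP => _; have := h01 i; lra.
suff w1 : (1 <= \sum_(i in S j) w i)%R.
  have -> : (\sum_i (\row_i ((i \in c.1)%:R - (i \in c.2)%:R)) 0 i * half_point R V x i =
    \sum_(i in S j) w i - #|c.2|%:R :> R)%R.
    have -> : (#|c.2|%:R = \sum_i (i \in c.2)%:R :> R)%R.
      by rewrite -sum1_card natr_sum big_mkcond; apply: eq_bigr => i _; case: ifP.
    rewrite [X in (_ = X - _)%R]big_mkcond -sumrB /=.
    apply: eq_bigr => i _; rewrite mxE c1 inE /w.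
    have [ic|ic] /= := boolP (i \in c.2).
      by rewrite (subsetP c2) //; lra.
    by case: (i \in S j) => /=; lra.
  by rewrite ltrD2r ltNge w1.
have [jT|jT] := boolP (j \in T).
  have [i ij wi] : exists2 i, i \in S j & (x i != (i \in c.2)).
    apply/exists_inP; apply: contraT => /exists_inPn h.
    (* Otherwise the variables of [S j] true under [x] would be exactly those of [c.2], which have
       the wrong parity. *)
    case/eqP: cb; rewrite -(Tsat j jT); apply/esym/parity_card => // i ij.
    by have /negPn/eqP := h i ij.
  rewrite (bigD1 i) //= ler_wpDr ?sumr_ge0 //.
  have iV : i \in V by rewrite VE inE (subsetP (sub_neighbours S jT)) ?orbT.
  by rewrite /w /half_point iV; case: (x i) (i \in c.2) wi => [] [] //=; lra.
(* The single equation [j] is not critical: at least 4 of its variables stay at 1/2, and their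
   literals already sum to 2. *)
have := Tres [set j]; rewrite disjoints1 jT cards1 r0 -cards_eq0 cards1.
rewrite /critical cards1 -ltnNge => /(_ isT isT isT) bd.
have : (\sum_(i in boundary S [set j] V) 2^-1 <= \sum_(i in S j) w i :> R)%R.
  rewrite big_mkcond [leRHS]big_mkcond /=; apply: ler_sum => i _.
  case: ifP => [/boundaryP[iV [j' [/set1P -> ij] _]]|_]; last by case: ifP.
  by rewrite ij /w /half_point (negbTE iV); case: ifP; lra.
rewrite sumr_const; apply: le_trans.
have : (4%:R <= #|boundary S [set j] V|%:R :> R)%R by rewrite ler_nat.
by rewrite -[X in _ -> (_ <= X)%R]mulr_natr; lra.
Qed.

Lemma depth_ge (p : sem_proof R n) (F : cnf n) t :
  (forall c, c \in F -> exists j, [/\ c.1 = S j :\: c.2, c.2 \subset S j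
     & odd #|c.2| != b j]) ->
  refutation F p -> 4 * t <= r -> t <= depth p.
Proof.
move=> Fb [valid unsat].
have [->//|t0 tr] := eqVneq t 0.
have r0 : 0 < r by apply: leq_trans tr; rewrite muln_gt0 /= lt0n.
(* [q] lists the lines visited before [i]. Premises have smaller indices, hence [i + s <= psize p],
   which keeps the path length within the range of the maximum in [depth]. *)
have walk s : s <= t -> exists i V x (q : s.-tuple 'I_(psize p).+1),
    [/\ state s V x, falsified V x (line p i), path (dag_edge p) i q & i + s <= psize p].
  elim: s => [_|s IHs st].
    exists ord_max, set0, [ffun=> false], [tuple]; split=> //.
    - exact: initial_state.
    - exact: unsat_falsified.
    - by rewrite addn0 -ltnS.
  have [i [V [x [q [st1 fl pq iq]]]]] := IHs (ltnW st).
  case: (valid i) => [[inp _]|[c2 lt ent]].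
    by case: (input_not_falsified Fb r0 st1 inp fl).
  have [j [P [x' [ji Pc x'V flj]]]] := falsified_premise ent fl.
  have str : 4 * s.+1 <= r by apply: leq_trans tr; rewrite leq_mul2l.
  have [V' [y [st' fl']]] := next_state st1 (leq_trans Pc c2) str x'V flj.
  exists j, V', y, [tuple of i :: q]; split=> //=; first by rewrite /dag_edge ji.
  by apply: leq_trans iq; rewrite addnS ltn_add2r lt.
have [i [_ [_ [q [_ _ pq iq]]]]] := walk t (leqnn t).
have tp : t < (psize p).+1 by rewrite ltnS (leq_trans (leq_addl i t)).
apply: (@leq_bigmax_cond _ _ (fun l : 'I_(psize p).+1 => l : nat) (Ordinal tp)).
by apply/existsP; exists i; apply/existsP; exists q.
Qed.

End DepthBound.

(** * Counting samples *)

Section Frequency.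
Variables (R : realType) (T : finType) (D : {set T}) (m : nat).
Local Open Scope ring_scope.
Implicit Types (E : pred {ffun 'I_m -> T}).

Definition frequency E : R := #|[set w in ffun_on D | E w]|%:R / (#|D| ^ m)%N%:R.

Lemma sample_probE (E : {ffun 'I_m -> T} -> Prop) :
  sample_prob R D E = frequency (fun w => `[< E w >]).
Proof.
rewrite /sample_prob /frequency; congr (_ / _%:R).
by rewrite cardsE card_ffun_on card_ord.
Qed.

Lemma frequency_le1 E : frequency E <= 1.
Proof.
have [D0|D0] := eqVneq (#|D| ^ m)%N 0%N.
  by rewrite /frequency D0 invr0 mulr0.
rewrite ler_pdivrMr ?ltr0n ?lt0n // mul1r ler_nat.
rewrite -[X in (_ <= _ ^ X)%N]card_ord -(card_ffun_on _ D).
by apply/subset_leq_card/subsetP => w; rewrite inE => /andP[].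
Qed.

Lemma frequency_predT : D != set0 -> frequency predT = 1.
Proof.
move=> D0; rewrite /frequency (_ : [set w in _ | _] = [set w in ffun_on D]).
  rewrite cardsE card_ffun_on card_ord divff // pnatr_eq0 expn_eq0 cards_eq0.
  by rewrite (negbTE D0).
by apply/setP => w; rewrite !inE andbT.
Qed.

(** The union bound; covering [E] is required only on samples from [D]. *)
Lemma frequency_bigU (I : finType) (P : pred I) (E : pred {ffun 'I_m -> T})
    (F : I -> pred {ffun 'I_m -> T}) :
  (forall w, w \in ffun_on D -> E w -> exists2 i, P i & F i w) ->
  frequency E <= \sum_(i | P i) frequency (F i).
Proof.
move=> EF; rewrite /frequency -mulr_suml ler_wpM2r // -natr_sum ler_nat.
apply: leq_trans (_ : #|\bigcup_(i | P i) [set w in ffun_on D | F i w]| <= _)%N.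
  apply/subset_leq_card/subsetP => w; rewrite inE => /andP[wD Ew].
  by have [i Pi Fi] := EF w wD Ew; apply/bigcupP; exists i => //; rewrite inE wD.
elim/big_rec2: _ => [|i x X _ le]; first by rewrite cards0.
by apply: leq_trans (leq_card_setU _ _) _; rewrite leq_add2l.
Qed.

(** Independence of the draws: the samples counted form a product of copies of [D'] and of [D]. *)
Lemma frequency_box (A : {set 'I_m}) (D' : {set T}) :
  D' \subset D -> D != set0 ->
  frequency (fun w => [forall j in A, w j \in D']) = (#|D'|%:R / #|D|%:R) ^+ #|A|.
Proof.
move=> D'D D0; rewrite /frequency.
have -> : #|[set w in ffun_on D | [forall j in A, w j \in D']]| =
    (#|D'| ^ #|A| * #|D| ^ (m - #|A|))%N.
  rewrite -(@eq_card _ (family (fun j => if j \in A then mem D' else mem D))); last first.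
    move=> w; rewrite inE; apply/familyP/andP => [h|[/ffun_onP h1 /forall_inP h2] j].
      split; first by apply/ffun_onP => j; have := h j; case: ifP => // _ /(subsetP D'D).
      by apply/forall_inP => j jA; have := h j; rewrite jA.
    by case: ifP => [/h2|_] //; apply: h1.
  rewrite card_family foldrE big_map big_enum /= (bigID (mem A)) /=.
  rewrite (eq_bigr (fun=> #|D'|)) => [|j ->//].
  rewrite prod_nat_const [X in (_ * X)%N](eq_bigr (fun=> #|D|)) => [|j /negbTE ->//].
  rewrite prod_nat_const; congr (_ * _ ^ _)%N.
  by rewrite -[X in (X - _)%N]card_ord -(cardC A) addKn; apply: eq_card => j; rewrite !inE.
have Am : (#|A| <= m)%N by rewrite -[X in (_ <= X)%N]card_ord max_card.
rewrite -[X in (#|D| ^ X)%N%:R](subnKC Am) expnD !natrM !natrX expr_div_n.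
have d0 : (#|D|%:R != 0 :> R) by rewrite pnatr_eq0 cards_eq0.
by rewrite invfM mulrACA divff ?mulr1 // expf_neq0.
Qed.

End Frequency.

(** * Constraints grouped by their sets of variables *)

Section Fibres.
Variables (T : finType) (D : {set T}) (n k M : nat) (supp : T -> {set 'I_n}).
Hypothesis supp_k : forall t, t \in D -> #|supp t| = k.
Hypothesis card_fibre : forall X : {set 'I_n}, #|X| = k ->
  #|[set t in D | supp t == X]| = M.

Lemma card_by_support (P : pred T) :
  #|[set t in D | P t]| =
  \sum_(X : {set 'I_n} | #|X| == k) #|[set t in D | P t && (supp t == X)]|.
Proof.
rewrite -sum1_card (partition_big supp (fun X : {set 'I_n} => #|X| == k)) /=; last first.
  by move=> t; rewrite inE => /andP[/supp_k ->].
apply: eq_bigr => X _; rewrite -sum1_card; apply: eq_bigl => t.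
by rewrite !inE andbA.
Qed.

Lemma card_support_subset (B : {set 'I_n}) :
  #|[set t in D | supp t \subset B]| = 'C(#|B|, k) * M.
Proof.
rewrite card_by_support -cards_draws -sum_nat_const.
rewrite [RHS](eq_bigl (fun X : {set 'I_n} => (#|X| == k) && (X \subset B))); last first.
  by move=> X; rewrite inE andbC.
rewrite big_mkcondr; apply: eq_bigr => X /eqP Xk.
case: ifP => XB.
  rewrite -(card_fibre Xk); apply: eq_card => t; rewrite !inE.
  by case: eqP => [->|]; rewrite ?XB ?andbF.
apply/eqP; rewrite cards_eq0; apply/eqP/setP => t; rewrite !inE.
by case: eqP => [->|]; rewrite ?XB ?andbF.
Qed.

Lemma card_domain : #|D| = 'C(n, k) * M.
Proof.
rewrite -[X in 'C(X, k)]card_ord -cardsT -card_support_subset.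
by apply: eq_card => t; rewrite inE subsetT andbT.
Qed.

(** Every fibre contains a constraint failing [P], so at most [M.-1] of its elements remain. *)
Lemma card_satisfied (P : pred T) :
  (forall X : {set 'I_n}, #|X| = k -> exists t, [/\ t \in D, supp t = X & ~~ P t]) ->
  #|[set t in D | P t]| <= 'C(n, k) * M.-1.
Proof.
move=> hP; rewrite card_by_support -[X in 'C(X, k)]card_ord -card_draws -sum_nat_const.
rewrite [leqRHS](eq_bigl (fun X : {set 'I_n} => #|X| == k)); last first.
  by move=> X; rewrite inE.
apply: leq_sum => X /eqP Xk; have [t [tD tX Pt]] := hP X Xk.
rewrite -(card_fibre Xk) (cardsD1 t [set t in D | supp t == X]) inE tD tX eqxx.
apply/subset_leq_card/subsetP => s; rewrite !inE => /and3P[-> Ps ->].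
by rewrite !andbT; apply: contraNneq Pt => <-.
Qed.

End Fibres.

(** * Elementary binomial estimates *)

Lemma exp_le_fact b : b ^ b <= 4 ^ b * b`!.
Proof.
(* The falling factorial is ['C(b + b, b)] times the factorial of [b], and that binomial is one term
   of the expansion of [(1 + 1) ^ (b + b)]. *)
have le1 : b ^ b <= (b + b) ^_ b.
  rewrite ffact_prod -[X in _ ^ X]card_ord -prod_nat_const.
  by apply: leq_prod => i _; have := ltn_ord i; lia.
apply: leq_trans le1 _; rewrite -bin_ffact leq_mul2r; apply/orP; right.
have -> : 4 ^ b = (1 + 1) ^ (b + b) by rewrite (_ : b + b = 2 * b) ?expnM // mul2n addnn.
rewrite expnDn (bigD1 (inord b)) //= inordK; last by rewrite ltnS leq_addr.
by rewrite !exp1n !muln1 leq_addr.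
Qed.

(** The usual bound (e n / b)^b on a binomial coefficient, with 4 for e and cleared of division. *)
Lemma bin_exp_le n b : 'C(n, b) * b ^ b <= (4 * n) ^ b.
Proof.
rewrite expnMn; apply: leq_trans (leq_mul (leqnn _) (exp_le_fact b)) _.
rewrite mulnCA leq_mul2l bin_ffact ffact_prod -[X in _ <= _ ^ X]card_ord.
by rewrite -prod_nat_const; apply/orP; right; apply: leq_prod => i _; apply: leq_subr.
Qed.

(** Factor by factor, [(b - i) * n <= (n - i) * b]. *)
Lemma bin_ratio_le n b k : b <= n -> 'C(b, k) * n ^ k <= 'C(n, k) * b ^ k.
Proof.
move=> bn; rewrite -(leq_pmul2r (fact_gt0 k)) mulnAC bin_ffact [leqRHS]mulnAC bin_ffact.
rewrite !ffact_prod -[X in _ ^ X]card_ord -[X in _ * b ^ X]card_ord -!prod_nat_const -!big_split /=.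
by apply: leq_prod => i _; rewrite !mulnBl (mulnC b n) leq_sub2l // leq_mul2l bn orbT.
Qed.

(** * The union bound *)

Lemma superset_card (T : finType) (A : {set T}) b :
  #|A| <= b <= #|T| -> exists B : {set T}, A \subset B /\ #|B| = b.
Proof.
case/andP=> Ab bT; have [c] := ubnP (b - #|A|); elim: c A Ab => // c IHc A Ab lt.
have [E|ne] := eqVneq #|A| b; first by exists A.
have Alt : #|A| < b by rewrite ltn_neqAle ne.
have /card_gt0P[x xA] : 0 < #|~: A|.
  by rewrite cardsCs setCK subn_gt0 (leq_trans Alt).
rewrite inE in xA.
have [||B [AB Bb]] := IHc (x |: A); rewrite ?cardsU1 ?xA //.
  by move: #|A| Alt lt; lia.
by exists B; split=> //; apply: subset_trans AB; apply: subsetUr.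
Qed.

Section UnionBound.
Variable R : realType.
Local Open Scope ring_scope.

(** [4 * C] comes from choosing the equations, [4 ^ k] from choosing the variables that contain
    theirs, and [k ^ k] from [b <= k * a]. *)
Definition union_constant (C k : nat) : nat := (4 * C * 4 ^ k * k ^ k)%N.

Lemma union_exponents k a b : (6 <= k)%N -> (0 < a)%N -> b = ((4 * k - 5) * a %/ 4)%N ->
  [/\ (0 < b)%N, (b <= k * a)%N & (5 * a <= 4 * (k * a - b))%N].
Proof.
move=> k6 a0 ->; rewrite mulnBl -mulnA.
have : (6 * a <= k * a)%N by rewrite leq_mul2r k6 orbT.
by move: (k * a)%N => X; split; lia.
Qed.

(* 4 (k a - b) >= 5 a for b = (4 k - 5) a / 4, so (a / n)^(k a - b) not only
   cancels the factor (n / a)^a but leaves (a / n)^(a / 4). *)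
Lemma union_term_le C k n a b (u : R) :
  (6 <= k)%N -> (0 < a)%N -> (k * a <= n)%N -> 0 <= u -> u ^+ 4 = a%:R / n%:R ->
  b = ((4 * k - 5) * a %/ 4)%N ->
  'C(C * n, a)%:R * 'C(n, b)%:R * ('C(b, k)%:R / 'C(n, k)%:R) ^+ a
    <= ((union_constant C k)%:R * u) ^+ a.
Proof.
move=> k6 a0 kan u0 u4 bE.
have [b0 bka exps] := union_exponents k6 a0 bE.
have n0 : (0 < n)%N by apply: leq_trans kan; rewrite muln_gt0 a0 (leq_trans _ k6).
have bn : (b <= n)%N by apply: leq_trans kan.
have kn : (k <= n)%N by apply: leq_trans kan; apply: leq_pmulr.
have an : (a <= n)%N by apply: leq_trans kan; apply: leq_pmull; apply: leq_trans k6.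
have nR : 0 < n%:R :> R by rewrite ltr0n.
have aR : 0 < a%:R :> R by rewrite ltr0n.
have bR : 0 < b%:R :> R by rewrite ltr0n.
pose beta : R := b%:R / n%:R.
have beta0 : 0 < beta by rewrite divr_gt0.
have beta0' := ltW beta0.
have u4gt : 0 < u ^+ 4 by rewrite u4 divr_gt0.
have ugt : 0 < u by rewrite lt_neqAle u0 andbT; apply: contraTneq u4gt => <-; rewrite expr0n ltxx.
have u1 : u <= 1.
  by rewrite -(@ler_pXn2r _ 4) ?nnegrE // u4 expr1n ler_pdivrMr // mul1r ler_nat an.
have h1 : 'C(C * n, a)%:R <= ((4 * C)%N%:R / u ^+ 4) ^+ a.
  rewrite u4 invf_div mulrA -natrM expr_div_n ler_pdivlMr ?exprn_gt0 //.
  by rewrite -!natrX -natrM ler_nat -mulnA bin_exp_le.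
have h2 : 'C(n, b)%:R <= 4 ^+ b * beta ^- b.
  rewrite -exprVn invf_div -exprMn mulrA expr_div_n ler_pdivlMr ?exprn_gt0 //.
  by rewrite -natrM -!natrX -natrM ler_nat bin_exp_le.
have h3 : 'C(b, k)%:R / 'C(n, k)%:R <= beta ^+ k.
  rewrite expr_div_n ler_pdivrMr ?ltr0n ?bin_gt0 // mulrAC ler_pdivlMr ?exprn_gt0 //.
  by rewrite -!natrX -!natrM ler_nat [leqRHS]mulnC bin_ratio_le.
have h4 : beta <= k%:R * u ^+ 4.
  by rewrite u4 mulrA ler_pM2r ?invr_gt0 // -natrM ler_nat.
apply: (@le_trans _ _ (((4 * C)%N%:R / u ^+ 4) ^+ a * (4 ^+ b * beta ^- b) * (beta ^+ k) ^+ a)).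
  apply: ler_pM => //; rewrite ?mulr_ge0 ?exprn_ge0 ?divr_ge0 //.
    exact: ler_pM.
  by apply: lerXn2r; rewrite ?nnegrE ?divr_ge0 ?exprn_ge0 // ltW.
have -> : ((4 * C)%N%:R / u ^+ 4) ^+ a * (4 ^+ b * beta ^- b) * (beta ^+ k) ^+ a =
    (4 * C)%N%:R ^+ a * 4 ^+ b * (u ^- (4 * a) * beta ^+ (k * a - b)).
  rewrite -exprM -[in LHS](subnK bka) exprD expr_div_n -exprM.
  have : beta ^+ b != 0 by rewrite expf_neq0 // gt_eqF.
  have : u ^+ (4 * a) != 0 by rewrite expf_neq0 // gt_eqF.
  by move=> ? ?; field; apply/andP.
apply: (@le_trans _ _ ((4 * C)%N%:R ^+ a * 4 ^+ (k * a) * (k%:R ^+ (k * a) * u ^+ a))).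
  apply: ler_pM; rewrite ?mulr_ge0 ?exprn_ge0 ?invr_ge0 ?exprn_ge0 //.
    by rewrite ler_wpM2l ?exprn_ge0 // ler_weXn2l // ler1n.
  apply: (@le_trans _ _ (u ^- (4 * a) * (k%:R * u ^+ 4) ^+ (k * a - b))).
    rewrite ler_wpM2l ?invr_ge0 ?exprn_ge0 //.
    by apply: lerXn2r; rewrite ?nnegrE ?mulr_ge0 ?exprn_ge0 // ltW.
  rewrite exprMn mulrCA; apply: ler_pM; rewrite ?mulr_ge0 ?invr_ge0 ?exprn_ge0 //.
    by apply: ler_weXn2l; rewrite ?ler1n ?leq_subr // (leq_trans _ k6).
  rewrite -exprM mulrC ler_pdivrMr ?exprn_gt0 // -exprD.
  (* As [u <= 1], the exponent [4 * (k * a - b)] may drop to [5 * a], of which [4 * a] pays for the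
     denominator. *)
  by apply: ler_wiXn2l => //; rewrite (leq_trans _ exps) // -mulSn.
rewrite /union_constant !natrM !natrX !exprMn -!exprM; lra.
Qed.

Lemma sum_half_powers r : \sum_(i < r) (i.+1%:R / 2 ^+ i) <= 4 :> R.
Proof.
suff -> : \sum_(i < r) (i.+1%:R / 2 ^+ i) = 4 - 2 * (r + 2)%:R / 2 ^+ r :> R.
  by rewrite lerBlDr lerDl divr_ge0 // ?mulr_ge0 ?exprn_ge0.
elim: r => [|r IHr]; first by rewrite big_ord0 expr0; lra.
have : 2 ^+ r != 0 :> R by rewrite expf_neq0.
by rewrite big_ord_recr /= IHr exprS !natrD -natr1 => ?; field.
Qed.

(** Supplies the [u] of [union_term_le], whose bound decays like (a / n)^(a / 4). *)
Definition fourth_root (x : R) : R := Num.sqrt (Num.sqrt x).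

Lemma fourth_rootX x : 0 <= x -> fourth_root x ^+ 4 = x.
Proof.
by move=> x0; rewrite -[4%N]/(2 * 2)%N exprM !sqr_sqrtr ?sqrtr_ge0.
Qed.

(** In term [i] one factor is kept, with [w <= i.+1 * v], and the other [i] are at most 1/2 because
    [16 * K ^ 4 * r <= n]. *)
Lemma sum_union_le K r n : (0 < n)%N -> (16 * K ^ 4 * r <= n)%N ->
  \sum_(i < r) (K%:R * fourth_root (i.+1%:R / n%:R)) ^+ i.+1
    <= 4 * K%:R * fourth_root (n%:R^-1).
Proof.
move=> n0 Krn; set v := fourth_root _.
have nR : 0 < n%:R :> R by rewrite ltr0n.
have v0 : 0 <= v by apply: sqrtr_ge0.
have v4 : v ^+ 4 = n%:R^-1 by rewrite fourth_rootX // invr_ge0 ltW.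
apply: (@le_trans _ _ (\sum_(i < r) K%:R * v * (i.+1%:R / 2 ^+ i))); last first.
  rewrite -mulr_sumr -[leRHS]mulrA [leRHS]mulrC ler_wpM2l ?mulr_ge0 //.
  exact: sum_half_powers.
apply: ler_sum => i _; set w := fourth_root _.
have w0 : 0 <= w by apply: sqrtr_ge0.
have w4 : w ^+ 4 = i.+1%:R / n%:R by rewrite fourth_rootX // divr_ge0 // ltW.
have half : K%:R * w <= 2^-1.
  rewrite -(@ler_pXn2r _ 4) ?nnegrE ?mulr_ge0 ?invr_ge0 // exprMn w4 mulrA ler_pdivrMr //.
  have : (16 * K ^ 4 * i.+1)%N%:R <= n%:R :> R.
    by rewrite ler_nat; apply: leq_trans Krn; rewrite leq_mul2l ltn_ord orbT.
  rewrite natrM natrM natrX exprVn; lra.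
have wv : w <= i.+1%:R * v.
  rewrite -(@ler_pXn2r _ 4) ?nnegrE ?mulr_ge0 // exprMn w4 v4 ler_pM2r ?invr_gt0 //.
  by rewrite -natrX ler_nat -{1}(expn1 i.+1) leq_pexp2l.
rewrite exprS; apply: (@le_trans _ _ ((K%:R * (i.+1%:R * v)) * 2^-1 ^+ i)).
  apply: ler_pM; rewrite ?exprn_ge0 ?mulr_ge0 //; first by rewrite ler_wpM2l.
  by apply: lerXn2r; rewrite ?nnegrE ?mulr_ge0 ?invr_ge0.
by rewrite exprVn; lra.
Qed.

End UnionBound.

(** * Random samples expand and are unsatisfiable *)

Section RandomSamples.
Variables (R : realType) (T : finType) (D : {set T}) (n k M C : nat).
Variable supp : T -> {set 'I_n}.
Hypothesis supp_k : forall t, t \in D -> #|supp t| = k.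
Hypothesis card_fibre : forall X : {set 'I_n}, #|X| = k ->
  #|[set t in D | supp t == X]| = M.
Hypotheses (M_gt0 : 0 < M) (k_ge6 : 6 <= k) (k_le : k <= n) (C_gt0 : 0 < C).

Let m := C * n.
Let K := union_constant C k.

Definition poorly_expanding r (w : {ffun 'I_m -> T}) : bool :=
  [exists A : {set 'I_m}, [&& 0 < #|A|, #|A| <= r
     & 4 * #|neighbours (supp \o w) A| < (4 * k - 5) * #|A|]].

Lemma domain_neq0 : D != set0.
Proof.
by rewrite -card_gt0 (card_domain supp_k card_fibre) muln_gt0 bin_gt0 k_le.
Qed.

(** Makes [16 * K ^ 4 * r <= n] imply the condition [k * a <= n] of [union_term_le] for sizes [a] up
    to [r]. *)
Lemma k_le_union_constant : k <= 16 * K ^ 4.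
Proof.
have k0 : 0 < k by apply: leq_trans k_ge6.
have kK : k <= K.
  apply: leq_trans (_ : k ^ k <= _); first by rewrite -{1}(expn1 k) leq_pexp2l.
  by rewrite /K /union_constant leq_pmull // !muln_gt0 C_gt0 expn_gt0.
apply: leq_trans kK (leq_trans _ (leq_pmull _ _)) => //.
have [->//|K0] := posnP K; by rewrite -{1}(expn1 K) leq_pexp2l.
Qed.

(** The neighbours of a poorly expanding set [A] of size [a] fit into a set [B] of exactly [b a]
    variables; the union bound runs over [a], [A] and [B]. *)
Lemma frequency_poorly_expanding r : 16 * K ^ 4 * r <= n ->
  (frequency R D (poorly_expanding r) <= 4 * K%:R * fourth_root (n%:R^-1))%R.
Proof.
move=> rn; have n0 : 0 < n by apply: leq_trans k_le; apply: leq_trans k_ge6.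
apply: le_trans (sum_union_le R n0 rn).
pose b a := (4 * k - 5) * a %/ 4.
pose covered (A : {set 'I_m}) (B : {set 'I_n}) (w : {ffun 'I_m -> T}) :=
  [forall j in A, w j \in [set t in D | supp t \subset B]].
(* Index [a] stands for size [a.+1], which leaves out the empty set. *)
pose Fa (a : 'I_r) (w : {ffun 'I_m -> T}) := [exists A : {set 'I_m}, (#|A| == a.+1) &&
  [exists B : {set 'I_n}, (#|B| == b a.+1) && covered A B w]].
have ka a : a < r -> k * a.+1 <= n.
  move=> ar; apply: leq_trans rn.
  by apply: leq_mul => //; apply: k_le_union_constant.
apply: le_trans (@frequency_bigU R T D m _ predT _ Fa _) _ => [w wD|].
  move=> /existsP[A /and3P[A0 Ar Abad]].
  have ltr : #|A|.-1 < r by rewrite prednK.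
  exists (Ordinal ltr) => //; apply/existsP; exists A; rewrite /= prednK // eqxx /=.
  have [b0 bka _] := union_exponents k_ge6 A0 (erefl (b #|A|)).
  have := ka _ ltr; rewrite prednK // => kan.
  have [|B [NB Bb]] := @superset_card _ (neighbours (supp \o w) A) (b #|A|).
    rewrite card_ord (leq_trans bka kan) andbT leq_divRL // mulnC; exact: ltnW.
  apply/existsP; exists B; rewrite Bb eqxx /=; apply/forall_inP => j jA.
  rewrite inE (ffun_onP wD) /=; apply: subset_trans NB.
  exact: (sub_neighbours (supp \o w) jA).
apply: ler_sum => a _; set c := ('C(b a.+1, k)%:R / 'C(n, k)%:R : R)%R.
have box (A : {set 'I_m}) (B : {set 'I_n}) : #|A| = a.+1 -> #|B| = b a.+1 ->
    frequency R D (covered A B) = (c ^+ a.+1)%R.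
  move=> Aa Bb; rewrite frequency_box ?Aa ?domain_neq0 //; last first.
    by apply/subsetP => t; rewrite inE => /andP[].
  rewrite (card_support_subset supp_k card_fibre) (card_domain supp_k card_fibre) Bb.
  by rewrite !natrM -mulf_div divff ?mulr1 // pnatr_eq0 -lt0n.
apply: le_trans (@frequency_bigU R T D m _ (fun A : {set 'I_m} => #|A| == a.+1) _
  (fun A w => [exists B : {set 'I_n}, (#|B| == b a.+1) && covered A B w]) _) _.
  by move=> w _ /existsP[A /andP[? ?]]; exists A.
apply: le_trans (_ : (\sum_(A : {set 'I_m} | #|A| == a.+1)
    \sum_(B : {set 'I_n} | #|B| == b a.+1) c ^+ a.+1 <= _)%R).
  apply: ler_sum => A /eqP Aa.
  apply: le_trans (@frequency_bigU R T D m _ (fun B : {set 'I_n} => #|B| == b a.+1) _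
    (fun B w => covered A B w) _) _.
    by move=> w _ /existsP[B /andP[? ?]]; exists B.
  by apply: ler_sum => B /eqP Bb; rewrite box.
have draws N d : #|[pred X : {set 'I_N} | #|X| == d]| = 'C(N, d).
  by rewrite -[X in 'C(X, _)]card_ord -card_draws; apply: eq_card => X; rewrite !inE.
rewrite !sumr_const !draws -mulrnA -[X in (X <= _)%R]mulr_natl mulnC natrM.
apply: union_term_le => //; first exact: ka.
  by apply: sqrtr_ge0.
by rewrite fourth_rootX // divr_ge0.
Qed.

Variable sat : assignment n -> pred T.
Hypothesis unsat_fibre : forall x (X : {set 'I_n}), #|X| = k ->
  exists t, [/\ t \in D, supp t = X & ~~ sat x t].

(** A fixed assignment satisfies each of the [C * n] draws with probability at most (M - 1) / M; the
    union bound over assignments costs a factor 2^n. *)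
Lemma frequency_satisfiable :
  (frequency R D (fun w : {ffun 'I_m -> T} =>
     [exists x : assignment n, [forall j, sat x (w j)]])
   <= (2 * (M.-1%:R / M%:R) ^+ C) ^+ n)%R.
Proof.
pose box x (w : {ffun 'I_m -> T}) := [forall j in [set: 'I_m], w j \in [set t in D | sat x t]].
apply: le_trans (@frequency_bigU R T D m _ predT _ box _) _ => [w wD /existsP[x /forallP wx]|].
  exists x => //; apply/forall_inP => j _.
  by rewrite inE wx (ffun_onP wD).
apply: le_trans (_ : (\sum_(x : assignment n) (M.-1%:R / M%:R) ^+ m <= _)%R).
  apply: ler_sum => x _; rewrite frequency_box ?domain_neq0 //; last first.
    by apply/subsetP => t; rewrite inE => /andP[].
  rewrite cardsT card_ord; apply: lerXn2r; rewrite ?nnegrE ?divr_ge0 //.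
  rewrite (card_domain supp_k card_fibre) ler_pdivrMr ?ltr0n ?muln_gt0 ?bin_gt0 ?k_le //.
  have M0 : (M%:R != 0 :> R)%R by rewrite pnatr_eq0 -lt0n.
  have -> : (M.-1%:R / M%:R * ('C(n, k) * M)%:R = ('C(n, k) * M.-1)%:R :> R)%R.
    by rewrite !natrM; field.
  by rewrite ler_nat (card_satisfied supp_k card_fibre) // => X; apply: unsat_fibre.
by rewrite sumr_const card_ffun card_bool card_ord [leRHS]exprMn -exprM -[leLHS]mulr_natl natrX lexx.
Qed.

End RandomSamples.

(** * Depth lower bounds with high probability *)

Section Asymptotics.
Variable R : realType.
Local Open Scope ring_scope.
Local Open Scope classical_set_scope.

Lemma cvg_fourth_root_inv : (fun n : nat => fourth_root (n%:R^-1 : R)) @ \oo --> (0 : R).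
Proof.
have inv : (fun n : nat => (n%:R^-1 : R)) @ \oo --> (0 : R).
  apply/gtr0_cvgV0; last exact: cvgr_idn.
  by near=> n; rewrite ltr0n; near: n; apply: nbhs_infty_gt.
have -> : (0 : R) = fourth_root 0 by rewrite /fourth_root !sqrtr0.
apply: (continuous_cvg _ _ inv).
by apply: continuous_comp; apply: sqrt_continuous.
Unshelve. all: by end_near.
Qed.

Lemma exists_small_power (q e : R) : 0 <= q < 1 -> 0 < e ->
  exists2 C : nat, (0 < C)%N & q ^+ C <= e.
Proof.
move=> /andP[q0 q1] e0; have nq : `|q| < 1 by rewrite ger0_norm.
have /cvgr0_norm_le/(_ _ e0)[N _ hN] := cvg_expr nq.
exists N.+1 => //; have := hN N.+1 (leqnSn N) => /=.
by rewrite ger0_norm // exprn_ge0.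
Qed.

End Asymptotics.

(** With [r = 4 * t], expansion is needed up to size [8 * t]. Neighbourhoods of size (k - 5/4) |A|
    give, by double counting, boundaries of size (k - 5/2) |A|, at least 7/2 |A| for [k >= 6]. *)
Lemma depth_ge_of_expansion (R : realType) (T : finType) (D : {set T}) n k C t
    (supp : T -> {set 'I_n}) (rhs : T -> bool) (w : {ffun 'I_(C * n) -> T})
    (F : cnf n) (p : sem_proof R n) :
  (6 <= k)%N -> (forall s, s \in D -> #|supp s| = k) -> w \in ffun_on D ->
  (forall c, c \in F -> exists j, [/\ c.1 = supp (w j) :\: c.2, c.2 \subset supp (w j)
     & odd #|c.2| != rhs (w j)]) ->
  ~~ poorly_expanding k supp (8 * t) w -> refutation F p -> (t <= depth p)%N.
Proof.
move=> k6 supp_k wD Fw exp ref.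
apply: (@depth_ge R n _ (supp \o w) (rhs \o w) (4 * t) _ p F) => // A.
rewrite mulnA => Ar; have [->|A0] := eqVneq A set0; first by rewrite cards0.
have := @card_neighbours_boundary _ _ (supp \o w) k A (fun j => supp_k _ (ffun_onP wD j)).
have : ((4 * k - 5) * #|A| <= 4 * #|neighbours (supp \o w) A|)%N.
  rewrite leqNgt; apply: contra exp => lt; apply/existsP; exists A.
  by rewrite card_gt0 A0 Ar lt.
have : (6 * #|A| <= k * #|A|)%N by rewrite leq_mul2r k6 orbT.
by rewrite mulnBl -mulnA; move: #|neighbours _ _| #|boundary _ _ _| #|A|; lia.
Qed.

Section WithHighProbability.
Variables (R : realType) (k M : nat) (T : nat -> finType).
Variables (D : forall n, {set T n}) (supp : forall n, T n -> {set 'I_n}).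
Variables (sat : forall n, assignment n -> pred (T n)) (rhs : forall n, pred (T n)).
Variable F : forall n m, {ffun 'I_m -> T n} -> cnf n.
Arguments F {n m}.
Hypothesis k_ge6 : 6 <= k.
Hypothesis supp_k : forall n (s : T n), s \in D n -> #|supp s| = k.
Hypothesis card_fibre : forall n (X : {set 'I_n}), #|X| = k ->
  #|[set s in D n | supp s == X]| = M.
Hypothesis M_gt0 : 0 < M.
Hypothesis unsat_fibre : forall n (x : assignment n) (X : {set 'I_n}), #|X| = k ->
  exists s, [/\ s \in D n, supp s = X & ~~ sat x s].
Hypothesis unsatF : forall n m (w : {ffun 'I_m -> T n}), w \in ffun_on (D n) ->
  ~~ [exists x, [forall j, sat x (w j)]] -> cnf_unsat (F w).
Hypothesis clausesF : forall n m (w : {ffun 'I_m -> T n}) c, w \in ffun_on (D n) ->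
  c \in F w -> exists j, [/\ c.1 = supp (w j) :\: c.2, c.2 \subset supp (w j)
     & odd #|c.2| != rhs (w j)].
Local Open Scope ring_scope.
Local Open Scope classical_set_scope.

(** Every sample is satisfiable, or poorly expanding, or requires the depth; the first two events
    are rare. *)
Lemma sample_prob_requires_depth_ge C n t (eps : R) :
  (0 < C)%N -> (k <= n)%N -> (16 * union_constant C k ^ 4 * (8 * t) <= n)%N ->
  eps * n%:R <= t%:R ->
  1 - ((2 * (M.-1%:R / M%:R) ^+ C) ^+ n
      + 4 * (union_constant C k)%:R * fourth_root (n%:R^-1))
  <= sample_prob R (D n)
       (fun w : {ffun 'I_(C * n) -> T n} => requires_depth (F w) (eps * n%:R)).
Proof.
move=> C0 kn tn epst; rewrite sample_probE lerBlDr.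
have D0 := domain_neq0 (@supp_k n) (@card_fibre n) M_gt0 kn.
rewrite -[leLHS](frequency_predT R (C * n) D0).
pose E (i : 'I_3) : pred {ffun 'I_(C * n) -> T n} :=
  fun w => nth false [:: `[< requires_depth (F w) (eps * n%:R) >];
    [exists x, [forall j, sat x (w j)]]; poorly_expanding k (@supp n) (8 * t) w] i.
apply: le_trans (@frequency_bigU _ _ _ _ _ predT _ E _) _ => [w wD _|].
  have [sw|uw] := boolP [exists x, [forall j, sat x (w j)]].
    by exists 1.
  have [bw|ew] := boolP (poorly_expanding k (@supp n) (8 * t) w).
    by exists ord_max.
  exists ord0 => //=; apply/asboolP; split; first exact: unsatF.
  move=> p refp; apply: le_trans epst _; rewrite ler_nat.
  apply: (depth_ge_of_expansion (rhs := @rhs n) k_ge6 (@supp_k n) wD _ ew refp) => c.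
  exact: clausesF wD.
rewrite !big_ord_recl big_ord0 addr0 /= lerD2l lerD //.
  exact: (frequency_satisfiable R C (@supp_k n) (@card_fibre n) M_gt0 kn (@unsat_fibre n)).
exact: (frequency_poorly_expanding R (@supp_k n) (@card_fibre n) M_gt0 k_ge6 kn C0 tn).
Qed.

Lemma whp_requires_depth :
  exists m : nat -> nat,
    (exists C : nat, \forall n \near \oo, (m n <= C * n)%N) /\
    exists2 eps : R, 0 < eps &
      (fun n : nat => sample_prob R (D n)
         (fun w : {ffun 'I_(m n) -> T n} => requires_depth (F w) (eps * n%:R)))
        @ \oo --> (1 : R).
Proof.
have q01 : 0 <= (M.-1%:R / M%:R : R) < 1.
  by rewrite divr_ge0 //= ltr_pdivrMr ?ltr0n // mul1r ltr_nat prednK.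
(* This [C] makes the base [2 * q ^+ C] at most 1/2, for [q] = (M - 1) / M, so satisfiability has
   probability at most 2^-n. *)
have [|C C0 qC] := exists_small_power (e := 4^-1) q01; first by rewrite invr_gt0.
pose K := union_constant C k; pose L := (16 * K ^ 4 * 8)%N.
have K0 : (0 < K)%N.
  by rewrite /K /union_constant !muln_gt0 C0 !expn_gt0 (leq_trans _ k_ge6).
have L0 : (0 < L)%N by rewrite /L 2!muln_gt0 expn_gt0 K0.
exists (fun n => C * n)%N; split; first by exists C; near=> n.
have LR : 0 < L%:R :> R by rewrite ltr0n.
(* The depth is [t = n %/ L]; the factor 2 absorbs the rounding, as [n < t.+1 * L <= 2 * t * L] once
   [n >= L]. *)
exists ((2 * L%:R)^-1); first by rewrite invr_gt0 mulr_gt0.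
pose err n : R := (2^-1) ^+ n + 4 * K%:R * fourth_root (n%:R^-1).
apply: (@squeeze_cvgr _ _ _ _ (fun n => 1 - err n) (fun=> 1)).
- near=> n.
  rewrite [in X in _ && X]sample_probE frequency_le1 andbT.
  have nL : (L <= n)%N by near: n; apply: nbhs_infty_ge.
  have kn : (k <= n)%N by near: n; apply: nbhs_infty_ge.
  apply: le_trans (@sample_prob_requires_depth_ge C n (n %/ L) _ C0 kn _ _).
  + rewrite lerD2l lerN2 lerD2r; apply: lerXn2r; last by lra.
      by rewrite nnegrE mulr_ge0 ?exprn_ge0 //; case/andP: q01.
    by rewrite nnegrE invr_ge0.
  + by rewrite mulnA mulnC leq_divM.
  rewrite mulrC ler_pdivrMr ?mulr_gt0 // -!natrM ler_nat.
  have t1 : (0 < n %/ L)%N by rewrite divn_gt0.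
  have := ltn_ceil n L0; rewrite mulSn => lt; apply: ltnW; apply: leq_trans lt _.
  by rewrite mul2n -addnn mulnDr leq_add2r leq_pmull.
- suff : (fun n => 1 - err n) @ \oo --> (1 - (0 + 4 * K%:R * 0) : R).
    by rewrite mulr0 addr0 subr0.
  apply: cvgB; first by apply: cvg_cst.
  apply: cvgD.
    by apply: cvg_expr; rewrite ger0_norm ?invr_ge0 // invf_lt1 // ltr1n.
  by apply: cvgM; [apply: cvg_cst|apply: cvg_fourth_root_inv].
- exact: cvg_cst.
Unshelve. all: by end_near.
Qed.

End WithHighProbability.

(** * Random XOR formulas and random CNF formulas *)

Section Xor.
Variables n k : nat.

Lemma card_xor_fibre (X : {set 'I_n}) :
  #|X| = k -> #|[set e in k_xor_eqns n k | e.1 == X]| = 2.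
Proof.
move=> Xk; rewrite (_ : [set e in _ | _] = [set (X, true); (X, false)]).
  by rewrite cards2; case: eqP => // -[].
apply/setP => -[Y c]; rewrite !inE /= !xpair_eqE.
by case: (Y =P X) => [->|]; rewrite ?andbF // Xk eqxx; case: c.
Qed.

Lemma cnf_of_eqnsP m (w : {ffun 'I_m -> xor_eqn n}) (c : clause n) :
  c \in cnf_of_eqns w -> exists j,
    [/\ c.1 = (w j).1 :\: c.2, c.2 \subset (w j).1 & odd #|c.2| != (w j).2].
Proof.
case/bigcupP => j _ /imsetP[Z]; rewrite inE powersetE => /andP[ZS Zb] ->.
by exists j.
Qed.

Lemma cnf_of_eqns_unsat m (w : {ffun 'I_m -> xor_eqn n}) :
  ~~ [exists x : assignment n, [forall j, parity (w j).1 x == (w j).2]] ->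
  cnf_unsat (cnf_of_eqns w).
Proof.
rewrite negb_exists => /forallP wu; apply/forallP => x.
have := wu x; rewrite negb_forall => /existsP[j wj].
pose Z := [set i in (w j).1 | x i].
have ZS : Z \subset (w j).1 by apply/subsetP => i; rewrite inE => /andP[].
apply/existsP; exists ((w j).1 :\: Z, Z); apply/andP; split.
  apply/bigcupP; exists j => //; apply/imsetP; exists Z => //.
  rewrite inE powersetE ZS -(@parity_card _ (w j).1 Z x) // => i iS.
  by rewrite inE iS.
rewrite /clause_sat negb_or; apply/andP; split; apply/exists_inPn => i; rewrite !inE /=.
  by case: (i \in _) => //=; rewrite andbT.
by move/andP=> [_ ->].
Qed.

End Xor.

Section Clauses.
Variables n k : nat.

(** A clause on [X] is determined by its set of negated variables, an arbitrary subset of [X]. *)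
Lemma card_clause_fibre (X : {set 'I_n}) :
  #|X| = k -> #|[set c in k_clauses n k | c.1 :|: c.2 == X]| = 2 ^ k.
Proof.
move=> Xk; rewrite -Xk -card_powerset.
rewrite -(@card_imset _ _ (fun N : {set 'I_n} => (X :\: N, N))); last by move=> ? ? [].
apply: eq_card => -[P N]; rewrite !inE /=.
apply/idP/imsetP => [/andP[/andP[PN _] /eqP <-]|[Z]].
  exists N; first by rewrite powersetE subsetUr.
  by rewrite setDUl setDv setU0 (setDidPl PN).
rewrite powersetE => ZX [-> ->]; have -> : X :\: Z :|: Z = X.
  by rewrite -[RHS](setID X Z) (setIidPr ZX) setUC.
by rewrite !eqxx andbT -setI_eq0 setDE -setIA [_ :&: Z]setIC setICr setI0 eqxx.
Qed.

Lemma exists_falsified_clause (x : assignment n) (X : {set 'I_n}) : #|X| = k ->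
  exists c, [/\ c \in k_clauses n k, c.1 :|: c.2 = X & ~~ clause_sat x c].
Proof.
move=> Xk; pose N := [set i in X | x i].
have XN : X :\: N :|: N = X.
  by apply/setP => i; rewrite !inE; case: (i \in X); case: (x i).
exists (X :\: N, N); split=> //.
  rewrite inE /= XN Xk eqxx andbT -setI_eq0; apply/eqP/setP => i.
  by rewrite !inE; case: (i \in X); case: (x i).
rewrite /clause_sat negb_or; apply/andP; split; apply/exists_inPn => i; rewrite !inE /=.
  by case: (i \in _) => //=; rewrite andbT.
by move/andP=> [_ ->].
Qed.

(** On its own variables, a clause is falsified only by making true exactly the negated ones; the
    equation requiring the opposite parity therefore has it in its encoding. *)
Lemma cnf_of_clausesP m (w : {ffun 'I_m -> clause n}) c :
  w \in ffun_on (k_clauses n k) -> c \in cnf_of_clauses w -> exists j,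
    [/\ c.1 = ((w j).1 :|: (w j).2) :\: c.2, c.2 \subset (w j).1 :|: (w j).2
      & odd #|c.2| != ~~ odd #|(w j).2|].
Proof.
move=> wD /imsetP[j _ ->]; exists j; split; last by case: odd.
  have := ffun_onP wD j; rewrite inE => /andP[PN _].
  by rewrite setDUl setDv setU0 (setDidPl PN).
exact: subsetUr.
Qed.

Lemma cnf_of_clauses_unsat m (w : {ffun 'I_m -> clause n}) :
  ~~ [exists x : assignment n, [forall j, clause_sat x (w j)]] ->
  cnf_unsat (cnf_of_clauses w).
Proof.
rewrite negb_exists => /forallP wu; apply/forallP => x.
have := wu x; rewrite negb_forall => /existsP[j wj].
by apply/existsP; exists (w j); rewrite wj andbT; apply: imset_f.
Qed.

End Clauses.

Local Open Scope classical_set_scope.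
Local Open Scope ring_scope.

Theorem theorem5p15 (R : realType) :
  (forall k : nat, (6 <= k)%N ->
     exists m : nat -> nat,
       (exists C : nat, \forall n \near \oo, (m n <= C * n)%N) /\
       exists2 eps : R, 0 < eps &
         (fun n : nat => sample_prob R (k_xor_eqns n k)
            (fun w : {ffun 'I_(m n) -> xor_eqn n} =>
               requires_depth (cnf_of_eqns w) (eps * n%:R))) @ \oo --> (1 : R)) /\
  (forall k : nat, (6 <= k)%N ->
     exists m : nat -> nat,
       (exists C : nat, \forall n \near \oo, (m n <= C * n)%N) /\
       exists2 eps : R, 0 < eps &
         (fun n : nat => sample_prob R (k_clauses n k)
            (fun w : {ffun 'I_(m n) -> clause n} =>
               requires_depth (cnf_of_clauses w) (eps * n%:R))) @ \oo --> (1 : R)).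
Proof.
split=> k k6.
  apply: (@whp_requires_depth R k 2 xor_eqn (fun n => k_xor_eqns n k) (fun n e => e.1)
    (fun n x e => parity e.1 x == e.2) (fun n e => e.2) (fun n m w => cnf_of_eqns w)) => //.
  - by move=> n e; rewrite inE => /eqP.
  - by move=> n X; apply: card_xor_fibre.
  - move=> n x X Xk; exists (X, ~~ parity X x).
    by rewrite inE Xk eqxx; split=> //=; case: parity.
  - by move=> n m w _; apply: cnf_of_eqns_unsat.
  - by move=> n m w c _; apply: cnf_of_eqnsP.
(* Unsatisfiability is counted on the clauses themselves, one of the [2 ^ k] on each variable set
   being falsified; the associated equations serve the depth bound. *)
apply: (@whp_requires_depth R k (2 ^ k) clause (fun n => k_clauses n k)
  (fun n c => c.1 :|: c.2) clause_sat (fun n c => ~~ odd #|c.2|)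
  (fun n m w => cnf_of_clauses w)) => //.
- by move=> n c; rewrite inE => /andP[_ /eqP].
- by move=> n X; apply: card_clause_fibre.
- by rewrite expn_gt0.
- by move=> n x X; apply: exists_falsified_clause.
- by move=> n m w _; apply: cnf_of_clauses_unsat.
- by move=> n m w c; apply: cnf_of_clausesP.
Qed.
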